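(* Let $N$, $\tau_i$, $q_i$, $r_i$, $H$, the initial data and the planned disturbances $d_i[t]$ be as in the context, and assume that $d_i[t]=0$ for all $t>H+(\sigma_N-\sigma_i)$ and all $1\le i\le N$. Then the optimal inputs for the problem $$\min_{z,u,v}\ \sum_{t=0}^\infty\sum_{i=1}^N\big(q_iz_i[t]^2+r_iv_i[t]^2\big)$$ subject to the dynamics $z_i[t+1]=z_i[t]-u_{i-1}[t]+u_i[t-\tau_i]+v_i[t]+d_i[t]$ ($1\le i\le N$, $t\ge0$) and the given initial data and disturbances, are given, at every time $t\ge 0$, by $$v_i[t]=-\frac{X_i(1)}{r_i}\Big(\delta_{i-1}[t]+(1-h_{i-1})\mu_i[t]\Big),\qquad 1\le i\le N,$$ $$u_{i-1}[t]=\Big(1-\frac{\gamma_i}{q_i}\Big)\big(z_i[t]+u_i[t-\tau_i]+D_i[t+\sigma_i]\big)-a_i\,\delta_{i-1}[t]+c_i\,\mu_i[t]+d_i[t]-D_i[t+\sigma_i],\qquad 2\le i\le N,$$ where the parameters $\gamma_i,X_i(1),h_i,a_i,c_i$ and the variables $\delta_i[t],\mu_i[t],D_i[t]$ are computed from the problem data, the current levels $z_i[t]$ and the past flows $u_i[t-1],\dots,u_i[t-\tau_i]$ by the recursions in the context.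
   Context: Setting. $N\ge2$ is an integer (number of nodes of a directed path), $\tau_1,\dots,\tau_{N-1}$ are positive integers (delays), $q_i,r_i>0$ for $1\le i\le N$. For $t\ge0$ and $1\le i\le N$ the dynamics are $$z_i[t+1]=z_i[t]-u_{i-1}[t]+u_i[t-\tau_i]+v_i[t]+d_i[t],$$ with $u_0\equiv0$ and $u_N\equiv0$. Here $z_i[t]\in\mathbb R$ is the level at node $i$, $u_i[t]\in\mathbb R$ ($1\le i\le N-1$, $t\ge 0$) and $v_i[t]\in\mathbb R$ ($t\ge 0$) are the inputs, and $d_i[t]\in\mathbb R$ are given (known) planned disturbances. The initial data $z_i[0]$ and $u_i[s]$ for $-\tau_i\le s\le-1$ are given. Put $\sigma_k=\sum_{i=1}^{k-1}\tau_i$ (so $\sigma_1=0$). $H\ge0$ is an integer (horizon), and by convention $\tau_N:=H+1$. Define $D_i[t]=\sum_{j=1}^i d_j[t-\sigma_j]$. Empty products equal $1$. Parameters (Algorithm 1). - $\gamma_1=q_1$, $\rho_1=r_1$; for $2\le i\le N$: $\gamma_i=\frac{\gamma_{i-1}q_i}{\gamma_{i-1}+q_i}$, $\rho_i=\frac{\rho_{i-1}r_i}{\rho_{i-1}+r_i}$. - $X_N(H+2)=-\frac{\gamma_N}{2}+\sqrt{\gamma_N\rho_N+\frac{\gamma_N^2}{4}}$; for $i\le N-1$: $X_i(\tau_i)=\frac{\rho_i(X_{i+1}(1)+\gamma_i)}{X_{i+1}(1)+\gamma_i+\rho_i}$; and $X_i(s-1)=\frac{\rho_i(X_i(s)+\gamma_i)}{X_i(s)+\gamma_i+\rho_i}$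 for $1\le s-1\le\tau_i-1$ if $i\le N-1$, and for $1\le s-1\le H+1$ if $i=N$. - $g_i(j)=\frac{X_i(j)}{X_i(j)+\gamma_i}$ for $2\le j\le\tau_i$; $g_{i+1}(1)=\frac{X_{i+1}(1)}{X_{i+1}(1)+\gamma_i}$ for $1\le i\le N-1$; $b_i=g_{i+1}(1)\prod_{j=2}^{\tau_i}g_i(j)$ for $1\le i\le N-1$. - For $1\le l,m\le\tau_i$: $P_i(1,m)=\frac{X_i(1)}{\rho_i}$, and for $l\ge2$: $P_i(l,m)=\big(1-\frac{X_i(l)}{\rho_i}\big)g_i(l)P_i(l-1,m)+\frac{X_i(l)}{\rho_i}$ if $l\le m$, $P_i(l,m)=\big(1-\frac{X_i(l)}{\rho_i}\big)P_i(l-1,m)+\frac{X_i(l)}{\rho_i}$ if $l>m$. - $h_0=0$, $h_1=P_1(\tau_1,\tau_1)g_2(1)$, and for $2\le i\le N-1$: $h_i=(1-P_i(\tau_i,1))b_ih_{i-1}+P_i(\tau_i,\tau_i)g_{i+1}(1)$. - For $1\le\Delta\le\tau_i$: $\phi_i(\Delta)=1-P_i(\tau_i,\Delta)-(1-P_i(\tau_i,1))h_{i-1}\prod_{j=2}^{\Delta}g_i(j)$. - $a_i=\frac{X_i(1)}{r_i}+\frac{\gamma_i}{q_i}\big(1-\frac{X_i(1)}{\rho_i}\big)$, $\quad c_i=-\Big(\frac{X_i(1)}{r_i}-\frac{\gamma_iX_i(1)}{q_i\rho_i}\Big)(1-h_{i-1})+\frac{\gamma_i}{q_i}h_{i-1}$.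 On-line variables (Algorithm 2), with $\delta_0[t]=0$ and $\mu_{N+1}[t]=0$ (so $\mu_N[t]=\pi_N[t]$): - $\Phi_i[t]=\phi_i(1)z_i[t]+\sum_{\Delta=0}^{\tau_i-1}\phi_i(\Delta+1)\big(u_i[t-(\tau_i-\Delta)]+D_i[t+\sigma_i+\Delta]\big)$, - $\delta_i[t]=\Phi_i[t]+(1-P_i(\tau_i,1))\delta_{i-1}[t]$ for $i=1,\dots,N$, - $\pi_i[t]=z_i[t]+\sum_{\Delta=0}^{\tau_i-1}\big(u_i[t-(\tau_i-\Delta)]+D_i[t+\sigma_i+\Delta]\big)\prod_{j=2}^{\Delta+1}g_i(j)$, - $\mu_i[t]=\pi_i[t]+b_i\mu_{i+1}[t]$ for $i=N,\dots,1$. *)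

(* Defs.v *)
From HB Require Import structures.
From mathcomp Require Import all_boot all_order all_algebra.
From mathcomp Require Import all_classical all_reals all_analysis.

Set Implicit Arguments.
Unset Strict Implicit.
Unset Printing Implicit Defensive.

Import Order.TTheory GRing.Theory Num.Theory.

Local Open Scope ring_scope.

(* Nodes are indexed 1..N, and families indexed by nodes are functions on [nat]
   whose values at other indices are irrelevant.  Signals take an integer time
   since the flows have a past; levels, external inputs and disturbances only
   matter at times >= 0. *)
Definition signal (R : Type) := nat -> int -> R.

Record problem (R : realType) := Problem {
  nodes : nat;              (* N *)
  delay : nat -> nat;       (* tau_i, for 1 <= i <= N-1 *)
  qw : nat -> R;            (* q_i *)
  rw : nat -> R;            (* r_i *)
  horizon : nat;            (* H *)
  level0 : nat -> R;        (* z_i[0] *)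
  flow0 : signal R;         (* u_i[s], for -tau_i <= s <= -1 *)
  dist : signal R           (* d_i[t] *)
}.

Section Defs.
Context {R : realType}.
Implicit Types (p : problem R) (z u v : signal R) (t : int).
Implicit Types (i j k l m s : nat).

(* The convention tau_N = H + 1 is built in.  It does not affect the dynamics,
   because u_N = 0. *)
Definition tau p i : nat := if i == nodes p then (horizon p).+1 else delay p i.

Definition sigma p k : nat := \sum_(1 <= i < k) delay p i.

Definition feasible p z u v : Prop :=
  [/\ forall t, u 0%N t = 0 /\ u (nodes p) t = 0,
      forall i, (1 <= i <= nodes p)%N -> z i 0 = level0 p i,
      forall i t, (1 <= i < nodes p)%N -> - (delay p i)%:Z <= t <= - 1 ->
        u i t = flow0 p i t
    & forall i t, (1 <= i <= nodes p)%N -> 0 <= t ->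
        z i (t + 1) =
          z i t - u i.-1 t + u i (t - (tau p i)%:Z) + v i t + dist p i t].

Definition cost p z v : \bar R :=
  (\sum_(0 <= k <oo)
     (\sum_(1 <= i < (nodes p).+1)
        (qw p i * z i k%:Z ^+ 2 + rw p i * v i k%:Z ^+ 2))%R%:E)%E.

Definition optimal p z u v : Prop :=
  feasible p z u v /\
  forall z' u' v', feasible p z' u' v' -> (cost p z v <= cost p z' v')%E.

(* w_1 and w_i = w_(i-1) w_i / (w_(i-1) + w_i); the value at 0 is junk. *)
Fixpoint parallel (w : nat -> R) i : R :=
  match i with
  | 0%N => 0
  | 1%N => w 1%N
  | i'.+1 => parallel w i' * w i / (parallel w i' + w i)
  end.

Definition gam p i : R := parallel (qw p) i.
Definition rho p i : R := parallel (rw p) i.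

Definition riccati p i (x : R) : R :=
  rho p i * (x + gam p i) / (x + gam p i + rho p i).

Definition Xend p : R :=
  let g := gam p (nodes p) in
  - (g / 2) + Num.sqrt (g * rho p (nodes p) + g ^+ 2 / 4).

(* [Xseed p (N - i)] is the value from which the backward recursion for
   X_i(tau_i), ..., X_i(1) starts: X_N(H+2) if i = N and X_(i+1)(1) otherwise. *)
Fixpoint Xseed p k : R :=
  match k with
  | 0%N => Xend p
  | k'.+1 =>
    iter (tau p (nodes p - k')) (riccati p (nodes p - k')) (Xseed p k')
  end.

(* The recursion equations are X_last, X_link and X_step below. *)
Definition X p i s : R :=
  iter ((tau p i).+1 - s) (riccati p i) (Xseed p (nodes p - i)).

Definition g p i j : R :=
  if j == 1%N then X p i 1 / (X p i 1 + gam p i.-1)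
  else X p i j / (X p i j + gam p i).

Definition gprod p i m : R := \prod_(2 <= j < m.+1) g p i j.

Definition b p i : R := g p i.+1 1 * gprod p i (tau p i).

Fixpoint P p i l m : R :=
  match l with
  | 0%N => 0
  | 1%N => X p i 1 / rho p i
  | l'.+1 =>
    if (l <= m)%N
    then (1 - X p i l / rho p i) * g p i l * P p i l' m + X p i l / rho p i
    else (1 - X p i l / rho p i) * P p i l' m + X p i l / rho p i
  end.

Fixpoint h p i : R :=
  match i with
  | 0%N => 0
  | 1%N => P p 1 (tau p 1) (tau p 1) * g p 2 1
  | i'.+1 => (1 - P p i (tau p i) 1) * b p i * h p i'
             + P p i (tau p i) (tau p i) * g p i.+1 1
  end.

Definition phi p i m : R :=
  1 - P p i (tau p i) m - (1 - P p i (tau p i) 1) * h p i.-1 * gprod p i m.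

Definition a p i : R :=
  X p i 1 / rw p i + gam p i / qw p i * (1 - X p i 1 / rho p i).

Definition c p i : R :=
  - (X p i 1 / rw p i - gam p i * X p i 1 / (qw p i * rho p i))
      * (1 - h p i.-1)
  + gam p i / qw p i * h p i.-1.

Definition D p i t : R := \sum_(1 <= j < i.+1) dist p j (t - (sigma p j)%:Z).

(* u_i[t - (tau_i - k)] + D_i[t + sigma_i + k] *)
Definition inflow p u i t k : R :=
  u i (t - (tau p i - k)%N%:Z) + D p i (t + (sigma p i)%:Z + k%:Z).

Definition Phi p z u i t : R :=
  phi p i 1 * z i t + \sum_(0 <= k < tau p i) phi p i k.+1 * inflow p u i t k.

Fixpoint delta p z u i t : R :=
  match i with
  | 0%N => 0
  | i'.+1 => Phi p z u i t + (1 - P p i (tau p i) 1) * delta p z u i' t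
  end.

Definition ppi p z u i t : R :=
  z i t + \sum_(0 <= k < tau p i) inflow p u i t k * gprod p i k.+1.

(* [mu_rec p z u k t] is mu_(N+1-k)[t]; b_N only occurs multiplied by
   mu_(N+1) = 0. *)
Fixpoint mu_rec p z u k t : R :=
  match k with
  | 0%N => 0
  | k'.+1 => ppi p z u (nodes p - k') t
             + b p (nodes p - k') * mu_rec p z u k' t
  end.

Definition mu p z u i t : R := mu_rec p z u ((nodes p).+1 - i) t.

Definition external_law p z u v i t : Prop :=
  v i t = - (X p i 1 / rw p i)
          * (delta p z u i.-1 t + (1 - h p i.-1) * mu p z u i t).

Definition flow_law p z u i t : Prop :=
  u i.-1 t =
    (1 - gam p i / qw p i)
      * (z i t + u i (t - (tau p i)%:Z) + D p i (t + (sigma p i)%:Z))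
    - a p i * delta p z u i.-1 t + c p i * mu p z u i t
    + dist p i t - D p i (t + (sigma p i)%:Z).

Lemma X_last p : X p (nodes p) (horizon p).+2 = Xend p.
Proof. by rewrite /X /tau eqxx !subnn. Qed.

Lemma X_link p i : (i < nodes p)%N ->
  X p i (tau p i) = riccati p i (X p i.+1 1).
Proof.
move=> ltiN; rewrite /X subSnn [in RHS]subSS subn0 -(subnSK ltiN) /=.
by rewrite (subKn ltiN).
Qed.

Lemma X_step p i s : (1 < s <= (tau p i).+1)%N ->
  X p i s.-1 = riccati p i (X p i s).
Proof.
by case: s => [//|s] /andP[_]; rewrite ltnS /X subSS => les; rewrite subSn.
Qed.

Lemma mu_last p z u t : mu p z u (nodes p).+1 t = 0.
Proof. by rewrite /mu subnn. Qed.

Lemma mu_step p z u i t : (1 <= i <= nodes p)%N ->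
  mu p z u i t = ppi p z u i t + b p i * mu p z u i.+1 t.
Proof. by case/andP=> _ leiN; rewrite /mu subSn//= subSS subKn. Qed.

End Defs.

(* Main.v *)
Require Import Defs.
From HB Require Import structures.
From mathcomp Require Import all_boot all_order all_algebra.
From mathcomp Require Import all_classical all_reals all_analysis.
From mathcomp Require Import ring lra zify.

(** The problem is convex, so a stationary trajectory that decays is optimal,
    and delaying node [i] by [sigma p i] makes stationarity a scalar problem.

    Optimality in [u i t] says that the multipliers of nodes [i] and [i.+1]
    agree once time is delayed by [sigma], so that a single sequence [w]
    serves all nodes: [rw p i * v i n = w (n + sigma p i)] and
    [qw p i * z i n.+1 = w (n + sigma p i).+1 - w (n + sigma p i)]
    ([stationary]). Summing the dynamics of nodes 1, ..., i along the same
    delays cancels the flows between them ([delayed_sum_dynamics]); what is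
    left is a scalar linear-quadratic regulator at each delayed time [s], for
    the total level of the nodes [j] with [sigma p j <= s]. A total is shared
    among these nodes at least cost in inverse proportion to their weights,
    whence the parallel weights [gam] and [rho]. A flow only constrains the
    totals when it was decided in the past, and then it is a known input.

    The scalar regulator has affine feedback
    [w = - X * (level + weighted future inputs)], where [X] solves the
    Riccati recursion and the weights are products of the gains [g]; once the
    disturbances have ended the feedback is the constant one ([terminal]), and
    from there it propagates backwards ([costate_feedback]). Written from an
    arbitrary time [t], the weighted sum at [sigma p i] is [mu]
    ([mu_weighted_future]) and the level predicted to arrive there is
    [delta p z u i.-1 t - h p i.-1 * mu p z u i t] ([pre_level_sigma]), because
    [P] is the closed-loop response to an input at one given delayed time
    ([closed_loop_response]). Reading [v] off [w] gives the external law, and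
    reading [z i t.+1] off the next scalar level gives the flow law. So a
    stationary trajectory follows both laws.

    Such a trajectory is obtained by running the scalar feedback from time 0
    and distributing the result over the nodes ([opt_feasible]). It is the
    unique optimum: testing stationarity against any feasible trajectory
    telescopes to one boundary product ([pairing_costate]), so the excess cost
    of a competitor is the energy of the difference, up to a product that
    vanishes because [w] decays geometrically ([stationary_gap]). Since the
    laws determine a feasible trajectory step by step ([law_unique]), following
    them and being optimal are the same thing. *)

Set Implicit Arguments.
Unset Strict Implicit.
Unset Printing Implicit Defensive.

Import Order.TTheory GRing.Theory Num.Theory.

Local Open Scope ring_scope.

(** * Weights in parallel *)

Section Parallel.
Context {R : realType}.
Implicit Types (w : nat -> R) (i n : nat).

Lemma parallelS w i : (0 < i)%N ->
  parallel w i.+1 = parallel w i * w i.+1 / (parallel w i + w i.+1).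
Proof. by case: i. Qed.

Lemma parallel_gt0 w n i :
  (forall j, (1 <= j <= n)%N -> 0 < w j) -> (1 <= i <= n)%N -> 0 < parallel w i.
Proof.
move=> w0; elim: i => [//|[_ lein|i IH lein]]; first exact: w0.
have wi := w0 _ lein; have wp : 0 < parallel w i.+1 by apply: IH; lia.
by rewrite parallelS// divr_gt0 ?mulr_gt0 ?addr_gt0.
Qed.

Lemma sum_inv_parallel w n i :
  (forall j, (1 <= j <= n)%N -> 0 < w j) -> (1 <= i <= n)%N ->
  \sum_(1 <= j < i.+1) (w j)^-1 = (parallel w i)^-1.
Proof.
move=> w0; elim: i => [//|[_ _|i IH lein]]; first by rewrite big_nat1.
have wi := w0 _ lein; have lein' : (1 <= i.+1 <= n)%N by lia.
have wp := parallel_gt0 w0 lein'.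
rewrite big_nat_recr// IH// (parallelS w (ltn0Sn i)).
move: (parallel w i.+1) (w i.+2) wp wi => x y x0 y0 /=.
by field; rewrite !lt0r_neq0// addr_gt0.
Qed.

End Parallel.

(** * The scalar system in delayed time *)

Section Scalar.
Context {R : realType} (p : problem R).
Hypothesis nodes_ge2 : (2 <= nodes p)%N.
Hypothesis delay_gt0 : forall i : nat, (1 <= i < nodes p)%N -> (0 < delay p i)%N.
Hypothesis qw_gt0 : forall i : nat, (1 <= i <= nodes p)%N -> 0 < qw p i.
Hypothesis rw_gt0 : forall i : nat, (1 <= i <= nodes p)%N -> 0 < rw p i.
Hypothesis dist_planned : forall (i : nat) (t : int), (1 <= i <= nodes p)%N ->
  (horizon p)%:Z + ((sigma p (nodes p))%:Z - (sigma p i)%:Z) < t ->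
  dist p i t = 0.
Implicit Types (z u v x : signal R) (i j k l s n t : nat).

Lemma gam_gt0 i : (1 <= i <= nodes p)%N -> 0 < gam p i.
Proof. exact: parallel_gt0. Qed.

Lemma rho_gt0 i : (1 <= i <= nodes p)%N -> 0 < rho p i.
Proof. exact: parallel_gt0. Qed.

Lemma sigma1 : sigma p 1 = 0%N.
Proof. by rewrite /sigma big_geq. Qed.

Lemma sigmaS k : (0 < k)%N -> sigma p k.+1 = (sigma p k + delay p k)%N.
Proof. by move=> k0; rewrite /sigma big_nat_recr. Qed.

Lemma sigma_le : {homo sigma p : j k / (j <= k)%N}.
Proof.
apply: homo_leq => [//|? ? ?|[|k]]; [exact: leq_trans| |].
  by rewrite /sigma !big_geq.
by rewrite [leqRHS]sigmaS ?leq_addr.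
Qed.

(** In delayed time node [j] starts at [sigma p j]; [seg s] is the last node
    that has started, so the nodes taking part at [s] are 1, ..., [seg s]. *)
Definition seg s : nat := \max_(1 <= j < (nodes p).+1 | (sigma p j <= s)%N) j.

Lemma seg_eq i s : (1 <= i <= nodes p)%N -> (sigma p i <= s)%N ->
  ((i < nodes p)%N -> (s < sigma p i.+1)%N) -> seg s = i.
Proof.
move=> iN lis si; apply/eqP; rewrite eqn_leq; apply/andP; split.
  apply/bigmax_leqP_seq => j; rewrite mem_index_iota => jN js.
  rewrite leqNgt; apply/negP => ij.
  have /si : (i < nodes p)%N by lia.
  by rewrite ltnNge (leq_trans _ js)// sigma_le.
by apply: (leq_bigmax_seq i); rewrite // mem_index_iota ltnS.
Qed.

Lemma segP s : [/\ (1 <= seg s <= nodes p)%N, (sigma p (seg s) <= s)%N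
  & (seg s < nodes p)%N -> (s < sigma p (seg s).+1)%N].
Proof.
suff [i [iN lis si]] : exists i, [/\ (1 <= i <= nodes p)%N, (sigma p i <= s)%N
    & (i < nodes p)%N -> (s < sigma p i.+1)%N] by rewrite (@seg_eq i).
elim: s => [|s [i [iN lis si]]].
  exists 1%N; rewrite sigma1; split=> [|//|_]; first by lia.
  by rewrite sigmaS// sigma1 delay_gt0.
have [iltN|] := ltnP i (nodes p); last first.
  by move=> leNi; exists i; split=> //; [exact: leqW | lia].
have := si iltN; rewrite leq_eqVlt => /orP[/eqP eqs|lts]; last first.
  by exists i; split=> //; exact: leqW.
exists i.+1; rewrite eqs; split=> // iltN'.
by rewrite [in ltnRHS]sigmaS// -addn1 leq_add2l delay_gt0.
Qed.

Lemma seg_in s : (1 <= seg s <= nodes p)%N. Proof. by case: (segP s). Qed.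

Lemma seg_add i k : (1 <= i <= nodes p)%N ->
  ((i < nodes p)%N -> (k < delay p i)%N) -> seg (sigma p i + k) = i.
Proof.
move=> iN ki; apply: seg_eq => //; first exact: leq_addr.
by move=> /ki; rewrite sigmaS ?ltn_add2l//; case/andP: iN.
Qed.

Lemma seg_sigma i : (1 <= i <= nodes p)%N -> seg (sigma p i) = i.
Proof.
move=> iN; rewrite -[sigma p i]addn0 seg_add// => iltN.
by apply: delay_gt0; lia.
Qed.

Lemma leq_seg j s : (1 <= j <= nodes p)%N -> (j <= seg s)%N = (sigma p j <= s)%N.
Proof.
move=> jN; have [sN lis si] := segP s; apply/idP/idP => [js|].
  by apply: leq_trans lis; exact: sigma_le.
apply: contraLR; rewrite -!ltnNge => ij.
by apply: leq_trans (si _) (sigma_le ij); lia.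
Qed.

Lemma seg_succ s : seg s.+1 = ((s.+1 == sigma p (seg s.+1)) + seg s)%N.
Proof.
have [sN lis si] := segP s.+1; set i := seg s.+1 in sN lis si *.
have [eqs|ne] := eqVneq s.+1 (sigma p i).
  have i1 : (1 < i)%N.
    by rewrite ltnNge; apply/negP => i1; move: eqs; rewrite (_ : i = 1%N) ?sigma1//; lia.
  have ei : i = i.-1.+1 by lia.
  suff -> : seg s = i.-1 by lia.
  apply: seg_eq; first by lia.
    rewrite -ltnS eqs [in ltnRHS]ei sigmaS; last by lia.
    by rewrite -addn1 leq_add2l delay_gt0//; lia.
  by rewrite -ei -eqs.
suff -> : seg s = i by [].
apply: seg_eq => //; first by rewrite -ltnS ltn_neqAle eq_sym ne.
by move=> /si /ltnW.
Qed.

Definition delayed_sum x i (t : int) : R := \sum_(1 <= j < i.+1) x j (t - (sigma p j)%:Z).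

Lemma delayed_sum0 x (t : int) : delayed_sum x 0 t = 0.
Proof. by rewrite /delayed_sum big_geq. Qed.

Lemma delayed_sumS x i (t : int) :
  delayed_sum x i.+1 t = delayed_sum x i t + x i.+1 (t - (sigma p i.+1)%:Z).
Proof. by rewrite /delayed_sum big_nat_recr. Qed.

(** Level of the scalar system at delayed time [s], counted from the actual
    time [t]. The nodes that carry it are those taking part one step before
    [s]: when [s = sigma p i], node [i] is left out, because its current level
    is data and not something that the earlier decisions could influence. *)
Definition pre_level z t s : R :=
  if s is s'.+1 then delayed_sum z (seg s') (t + s)%N else 0.

Definition joining_level z t s : R :=
  if s == sigma p (seg s) then z (seg s) t%:Z else 0.

Definition scalar_input z u t s : R :=
  joining_level z t s + inflow p u (seg s) t (s - sigma p (seg s)).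

Lemma delayed_sum_pre_level z t s :
  delayed_sum z (seg s) (t + s)%N = pre_level z t s + joining_level z t s.
Proof.
case: s => [|s].
  have seg0 : seg 0 = 1%N by have := @seg_sigma 1; rewrite sigma1; apply; lia.
  rewrite /joining_level /= seg0 sigma1 eqxx.
  by rewrite add0r /delayed_sum big_nat1 sigma1 subr0 addn0.
have eqseg := seg_succ s; rewrite /joining_level /=.
case: eqVneq eqseg => [eqs|_] eqseg; last first.
  by rewrite addr0 eqseg.
rewrite eqseg add1n delayed_sumS; congr (_ + z _ _).
by move: eqs; rewrite eqseg add1n; lia.
Qed.

(** The flow from node [j.+1] to [j] leaves [j.+1] and reaches [j] at the same
    delayed time, so it cancels in the sum; only the inflow of the last node
    survives. *)
Lemma delayed_sum_dynamics z u v i s : feasible p z u v ->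
  (1 <= i <= nodes p)%N -> (sigma p i <= s)%N ->
  delayed_sum z i s.+1 = delayed_sum z i s + delayed_sum v i s + D p i s
                 + u i (s%:Z - (sigma p i)%:Z - (tau p i)%:Z).
Proof.
move=> [u0 _ _ dyn]; elim: i => [//|i IH] iN lis.
have dyn_i := dyn i.+1 (s%:Z - (sigma p i.+1)%:Z) iN.
rewrite -![D p _ _]/(delayed_sum _ _ _) !delayed_sumS.
rewrite (_ : s.+1%:Z - (sigma p i.+1)%:Z = s%:Z - (sigma p i.+1)%:Z + 1); last by lia.
rewrite dyn_i /=; last by lia.
have [->|i0] := posnP i.
  by rewrite !delayed_sum0 (u0 _).1; ring.
rewrite -[delayed_sum (dist p) _ _]/(D p _ _) IH; [|lia|].
  2: exact: leq_trans (sigma_le (leqnSn i)) lis.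
have -> : s%:Z - (sigma p i)%:Z - (tau p i)%:Z = s%:Z - (sigma p i.+1)%:Z.
  by rewrite sigmaS// /tau ifF; lia.
by ring.
Qed.

(** At the last node [k] may exceed the conventional [tau], where the truncated
    subtraction in [inflow] departs from the true time; [u (nodes p) = 0] makes
    this harmless. *)
Lemma inflowE z u v i t k : feasible p z u v -> (1 <= i <= nodes p)%N ->
  ((i < nodes p)%N -> (k < delay p i)%N) ->
  inflow p u i t k = u i ((t + k)%N%:Z - (tau p i)%:Z) + D p i (t + sigma p i + k)%N.
Proof.
move=> [u0 _ _ _] iN ki; rewrite /inflow; congr (_ + _).
have [iltN|leNi] := ltnP i (nodes p).
  by have := ki iltN; rewrite /tau ifF => [ltk|]; [congr (u _ _)|]; lia.
by rewrite (_ : i = nodes p) ?(u0 _).2//; lia.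
Qed.

Lemma seg_offset s : (seg s < nodes p)%N -> (s - sigma p (seg s) < delay p (seg s))%N.
Proof.
by have [sN lis si] := segP s; move=> /si; rewrite sigmaS; lia.
Qed.

(** Seen from time [t], the flow that enters the nodes taking part at [s] was
    decided before [t]; this makes [scalar_input] known data. *)
Lemma pre_level_succ z u v t s : feasible p z u v ->
  pre_level z t s.+1 =
  pre_level z t s + scalar_input z u t s + delayed_sum v (seg s) (t + s)%N.
Proof.
move=> feas; have [sN lis _] := segP s.
rewrite {1}/pre_level addnS (delayed_sum_dynamics feas)//; last by lia.
rewrite delayed_sum_pre_level /scalar_input (inflowE _ feas)//; last exact: seg_offset.
rewrite (_ : t + sigma p (seg s) + (s - sigma p (seg s)) = t + s)%N; last by lia.
rewrite (_ : (t + (s - sigma p (seg s)))%N%:Z - (tau p (seg s))%:Z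
   = (t + s)%N%:Z - (sigma p (seg s))%:Z - (tau p (seg s))%:Z); last by lia.
by ring.
Qed.


(** * The Riccati sequence in delayed time *)

Lemma riccati_gt0 i (x : R) : (1 <= i <= nodes p)%N -> 0 < x -> 0 < riccati p i x.
Proof.
move=> iN x0; have g0 := gam_gt0 iN; have r0 := rho_gt0 iN.
by rewrite divr_gt0 ?mulr_gt0 ?addr_gt0.
Qed.

Lemma nodes_in : (1 <= nodes p <= nodes p)%N. Proof. by lia. Qed.

Lemma Xend_gt0 : 0 < Xend p.
Proof.
rewrite /Xend; set g := gam p _; set r := rho p _.
have g0 : 0 < g := gam_gt0 nodes_in; have r0 : 0 < r := rho_gt0 nodes_in.
have gr0 : 0 < g * r by rewrite mulr_gt0.
rewrite addrC subr_gt0 -[ltLHS]ger0_norm -?sqrtr_sqr; last by lra.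
by rewrite ltr_sqrt; nra.
Qed.

(** [Xend] is the positive root of [x ^+ 2 + gam * x = gam * rho]. *)
Lemma Xend_fix : riccati p (nodes p) (Xend p) = Xend p.
Proof.
have := Xend_gt0; have : Xend p ^+ 2 + gam p (nodes p) * Xend p
    = gam p (nodes p) * rho p (nodes p).
  rewrite /Xend; set g := gam p _; set r := rho p _.
  have g0 : 0 < g := gam_gt0 nodes_in; have r0 : 0 < r := rho_gt0 nodes_in.
  have gr0 : 0 < g * r by rewrite mulr_gt0.
  set q := Num.sqrt _.
  have qE : q ^+ 2 = g * r + g ^+ 2 / 4 by rewrite sqr_sqrtr//; nra.
  rewrite (_ : _ + _ = q ^+ 2 - g ^+ 2 / 4); last by field.
  by rewrite qE addrK.
have g0 := gam_gt0 nodes_in; have r0 := rho_gt0 nodes_in; rewrite /riccati.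
move: (Xend p) (gam p _) (rho p _) g0 r0 => x g r g0 r0 eqx x0.
apply: (@mulIf _ (x + g + r)); first by rewrite lt0r_neq0 ?addr_gt0.
rewrite divfK; first by lra.
by rewrite lt0r_neq0 ?addr_gt0.
Qed.

Lemma Xseed_gt0 k : (k < nodes p)%N -> 0 < Xseed p k.
Proof.
elim: k => [_|k IH ltkN /=]; first exact: Xend_gt0.
elim: (tau p _) => [|n IHn] /=; first by apply: IH; lia.
by apply: riccati_gt0 => //; lia.
Qed.

Lemma X_gt0 i s : (1 <= i <= nodes p)%N -> 0 < X p i s.
Proof.
move=> iN; rewrite /X; elim: (_ - s)%N => [|n IHn] /=.
  by apply: Xseed_gt0; lia.
exact: riccati_gt0.
Qed.

Lemma X_past i : (i < nodes p)%N -> X p i (tau p i).+1 = X p i.+1 1.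
Proof.
by move=> iN; rewrite {1}/X subnn -(subnSK iN) /= (subKn iN) /X subSS subn0.
Qed.

Lemma X_tail s : ((horizon p).+2 <= s)%N -> X p (nodes p) s = Xend p.
Proof.
by move=> Hs; rewrite /X /tau eqxx subnn (_ : (_ - s)%N = 0%N)//; lia.
Qed.

(** First delayed time from which no disturbance is left. *)
Definition settle_time : nat := (sigma p (nodes p) + (horizon p).+1)%N.

Definition scalar_X s : R := X p (seg s) (s - sigma p (seg s)).+1.

Definition gain s : R := scalar_X s.+1 / (scalar_X s.+1 + gam p (seg s)).

Lemma scalar_X_gt0 s : 0 < scalar_X s.
Proof. by apply: X_gt0; exact: seg_in. Qed.

Lemma tau_delay i : (i < nodes p)%N -> tau p i = delay p i.
Proof. by move=> iN; rewrite /tau ifF//; lia. Qed.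

Lemma tau_gt0 i : (1 <= i <= nodes p)%N -> (0 < tau p i)%N.
Proof. by move=> iN; rewrite /tau; case: eqP => // ne; apply: delay_gt0; lia. Qed.

Lemma ltn_tau i k : (k < tau p i)%N -> (i < nodes p)%N -> (k < delay p i)%N.
Proof. by move=> ki /tau_delay <-. Qed.

(** Both cases agree because [X p i (tau p i).+1 = X p i.+1 1]: the index
    running one past the segment of [i] already is the start of the next. *)
Lemma scalar_X_succ s : scalar_X s.+1 = X p (seg s) (s - sigma p (seg s)).+2.
Proof.
have [sN lis _] := segP s; have [sN1 lis1 _] := segP s.+1.
rewrite /scalar_X; have eqseg := seg_succ s; case: eqVneq eqseg => [eqs|_] eqseg.
  rewrite -eqs subnn eqseg add1n -X_past; last by rewrite eqseg in sN1; lia.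
  congr (X p _ _); rewrite tau_delay; last by rewrite eqseg in sN1; lia.
  by move: eqs; rewrite eqseg sigmaS; lia.
by rewrite eqseg add0n; congr (X p _ _); lia.
Qed.

Lemma scalar_X_riccati s : scalar_X s = riccati p (seg s) (scalar_X s.+1).
Proof.
have [sN lis si] := segP s; rewrite scalar_X_succ /scalar_X.
have [sH|Hs] := leqP (s - sigma p (seg s)).+2 (tau p (seg s)).+1.
  by rewrite -X_step.
have [sltN|leNs] := ltnP (seg s) (nodes p).
  by have := seg_offset sltN; rewrite -tau_delay//; lia.
have eN : seg s = nodes p by lia.
move: Hs; rewrite eN /tau eqxx => Hs.
by rewrite !X_tail ?Xend_fix//; lia.
Qed.

Lemma seg_tail s : (sigma p (nodes p) <= s)%N -> seg s = nodes p.
Proof. by move=> Ns; apply: seg_eq => //; lia. Qed.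

Lemma scalar_X_tail s : (settle_time <= s)%N -> scalar_X s = Xend p.
Proof.
by rewrite /settle_time /scalar_X => Ks; rewrite seg_tail ?X_tail//; lia.
Qed.

Lemma scalar_input_eq0 z u t s :
  (forall t' : int, u (nodes p) t' = 0) -> (settle_time <= s)%N ->
  scalar_input z u t s = 0.
Proof.
move=> u0; rewrite /settle_time => Ks.
have eN : seg s = nodes p by apply: seg_tail; lia.
rewrite /scalar_input /joining_level eN ifF; last by lia.
rewrite /inflow u0 !add0r /D big_nat big1// => j jN.
by apply: dist_planned; lia.
Qed.

Lemma scalar_input_tail z u v t s : feasible p z u v ->
  (settle_time <= s)%N -> scalar_input z u t s = 0.
Proof. by move=> [u0 _ _ _]; apply: scalar_input_eq0 => t'; case: (u0 t'). Qed.

(** The offset of the affine feedback: an input [k - s] steps ahead counts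
    with the product of the gains in between. *)
Definition weighted_future (f : nat -> R) s : R :=
  \sum_(s <= k < settle_time) f k * \prod_(s <= j < k) gain j.

Lemma weighted_future_tail f s : (settle_time <= s)%N -> weighted_future f s = 0.
Proof. by move=> Ks; rewrite /weighted_future big_geq. Qed.

Lemma weighted_future_rec f s : ((settle_time <= s)%N -> f s = 0) ->
  weighted_future f s = f s + gain s * weighted_future f s.+1.
Proof.
move=> f0; have [Ks|sK] := leqP settle_time s.
  by rewrite !weighted_future_tail ?f0 ?mulr0 ?addr0 ?leqW.
rewrite /weighted_future big_ltn// big_geq// mulr1 mulr_sumr; congr (_ + _).
by rewrite !big_nat; apply: eq_bigr => k ks; rewrite [in LHS]big_ltn; [ring|lia].
Qed.

(** One step of the Riccati recursion, backwards: affine feedback at a step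
    forces affine feedback one step earlier. Here [w] is the multiplier before
    the step, [y] the level, [e] the input and [m] the offset after it. *)
Lemma costate_backward i (x y e m w : R) : (1 <= i <= nodes p)%N -> 0 < x ->
  - x * (y + e + w / rho p i + m) - w = gam p i * (y + e + w / rho p i) ->
  w = - riccati p i x * (y + (e + x / (x + gam p i) * m)).
Proof.
move=> iN x0; have g0 := gam_gt0 iN; have r0 := rho_gt0 iN; rewrite /riccati.
move: (gam p i) (rho p i) g0 r0 => g r g0 r0 eqw.
have xg0 : x + g != 0 by rewrite lt0r_neq0 ?addr_gt0.
have xgr0 : x + g + r != 0 by rewrite lt0r_neq0 ?addr_gt0.
have r1 : r != 0 by rewrite lt0r_neq0.
have wE : w = w / r * r by rewrite divfK.
move: (w / r) wE eqw => a -> eqa.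
suff /(canRL (mulfK xgr0)) -> : a * (x + g + r) = - ((x + g) * (y + e) + x * m).
  by field; rewrite xg0.
by lra.
Qed.

Lemma costate_forward i (x y e m w : R) : (1 <= i <= nodes p)%N -> 0 < x ->
  w = - riccati p i x * (y + (e + x / (x + gam p i) * m)) ->
  - x * (y + e + w / rho p i + m) - w = gam p i * (y + e + w / rho p i).
Proof.
move=> iN x0; have g0 := gam_gt0 iN; have r0 := rho_gt0 iN; rewrite /riccati => ->.
by field; rewrite !lt0r_neq0 ?addr_gt0.
Qed.

(** * Stationary trajectories follow the laws *)

(** The first-order conditions. That [w] does not depend on the node expresses
    stationarity in the flows. *)
Definition stationary z v (w : nat -> R) : Prop :=
  forall i n, (1 <= i <= nodes p)%N ->
    rw p i * v i n = w (n + sigma p i)%N /\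
    qw p i * z i n.+1 = w (n + sigma p i).+1 - w (n + sigma p i)%N.

(** Among the solutions of the first-order conditions this selects the ones
    that do not blow up after the last disturbance. *)
Definition terminal z (w : nat -> R) : Prop :=
  forall s, (settle_time <= s)%N -> w s = - Xend p * delayed_sum z (nodes p) s.

(** All nodes share the same [w s], so their sum sees the weights in
    parallel. *)
Lemma delayed_sum_control z v w i s : stationary z v w -> (1 <= i <= nodes p)%N ->
  (sigma p i <= s)%N -> delayed_sum v i s = w s / rho p i.
Proof.
move=> st iN lis; rewrite /rho -(sum_inv_parallel rw_gt0)// mulr_sumr /delayed_sum.
rewrite !big_nat; apply: eq_bigr => j ji.
have jN : (1 <= j <= nodes p)%N by lia.
have ljs : (sigma p j <= s)%N by apply: leq_trans lis; apply: sigma_le; lia.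
have [rv _] := st j (s - sigma p j)%N jN.
rewrite subnK// in rv; rewrite -rv subzn// mulrC mulKf//.
by rewrite lt0r_neq0 ?rw_gt0.
Qed.

Lemma delayed_sum_level z v w i s : stationary z v w -> (1 <= i <= nodes p)%N ->
  (sigma p i <= s)%N -> delayed_sum z i s.+1 = (w s.+1 - w s) / gam p i.
Proof.
move=> st iN lis; rewrite /gam -(sum_inv_parallel qw_gt0)// mulr_sumr /delayed_sum.
rewrite !big_nat; apply: eq_bigr => j ji.
have jN : (1 <= j <= nodes p)%N by lia.
have ljs : (sigma p j <= s)%N by apply: leq_trans lis; apply: sigma_le; lia.
have [_ qz] := st j (s - sigma p j)%N jN.
rewrite subnK// in qz; rewrite -qz subzn; last exact: leqW.
by rewrite subSn// mulrC mulKf// lt0r_neq0 ?qw_gt0.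
Qed.

Lemma pre_level_costate z u v w t s : feasible p z u v -> stationary z v w ->
  pre_level z t s.+1 = pre_level z t s + scalar_input z u t s + w (t + s)%N / rho p (seg s).
Proof.
move=> feas st; have [sN lis _] := segP s.
by rewrite (pre_level_succ _ _ feas) (delayed_sum_control st)//; lia.
Qed.

Lemma costate_incr z v w t s : stationary z v w ->
  w (t + s).+1 - w (t + s)%N = gam p (seg s) * pre_level z t s.+1.
Proof.
move=> st; have [sN lis _] := segP s.
rewrite /pre_level addnS (delayed_sum_level st)//; last by lia.
by rewrite mulrC divfK// lt0r_neq0 ?gam_gt0.
Qed.

Lemma joining_level_tail z t s : (settle_time <= s)%N -> joining_level z t s = 0.
Proof.
rewrite /settle_time => Ks; rewrite /joining_level seg_tail; last by lia.
by rewrite ifF//; lia.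
Qed.

(** The feedback holds from the settling time on by [terminal], and it
    propagates backwards by [costate_backward]. *)
Lemma costate_feedback z u v w t s :
  feasible p z u v -> stationary z v w -> terminal z w ->
  w (t + s)%N = - scalar_X s * (pre_level z t s + weighted_future (scalar_input z u t) s).
Proof.
move=> feas st term; have [n sn] := ubnP (settle_time - s)%N.
elim: n => // n IH in s sn *; have [Ks|sK] := leqP settle_time s.
  rewrite weighted_future_tail// scalar_X_tail// addr0 term; last by lia.
  rewrite -(seg_tail (s := s)); last by move: Ks; rewrite /settle_time; lia.
  by rewrite delayed_sum_pre_level joining_level_tail// addr0.
have {}IH := IH s.+1 ltac:(lia); rewrite addnS in IH.
rewrite scalar_X_riccati weighted_future_rec; last exact: scalar_input_tail feas.
apply: costate_backward; [exact: seg_in|exact: scalar_X_gt0|].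
rewrite -(pre_level_costate _ _ feas st) -/(gain s) -(costate_incr _ _ st).
by rewrite IH.
Qed.

Lemma gain_seg i k : (1 <= i <= nodes p)%N -> ((i < nodes p)%N -> (k < delay p i)%N) ->
  gain (sigma p i + k) = g p i k.+2.
Proof. by move=> iN ki; rewrite /gain scalar_X_succ seg_add// addKn. Qed.

Lemma scalar_input_seg z u t i k : (1 <= i <= nodes p)%N ->
  ((i < nodes p)%N -> (k < delay p i)%N) ->
  scalar_input z u t (sigma p i + k) = (if k == 0%N then z i t else 0) + inflow p u i t k.
Proof.
move=> iN ki; rewrite /scalar_input /joining_level seg_add// addKn.
by rewrite -[X in _ == X]addn0 eqn_add2l.
Qed.

Lemma prod_gain i l : (1 <= i <= nodes p)%N -> ((i < nodes p)%N -> (l <= delay p i)%N) ->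
  \prod_(0 <= k < l) gain (sigma p i + k) = gprod p i l.+1.
Proof.
move=> iN li; rewrite /gprod -[2%N]add0n -[l.+2]addn2 big_addn addnK.
rewrite !big_nat; apply: eq_bigr => k kl; rewrite gain_seg ?addn2//.
by move/li; lia.
Qed.

Lemma weighted_future_unroll f s l : (forall n, (settle_time <= n)%N -> f n = 0) ->
  weighted_future f s = \sum_(0 <= k < l) f (s + k)%N * \prod_(0 <= j < k) gain (s + j)
            + \prod_(0 <= j < l) gain (s + j) * weighted_future f (s + l).
Proof.
move=> f0; elim: l => [|l IH]; first by rewrite !big_geq// add0r mul1r addn0.
rewrite IH !big_nat_recr//= [weighted_future f (s + l)]weighted_future_rec; last exact: f0.
by rewrite addnS; ring.
Qed.

Lemma gprod1 i : gprod p i 1 = 1. Proof. by rewrite /gprod big_geq. Qed.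

Lemma ppi_input z u t i : (1 <= i <= nodes p)%N ->
  ppi p z u i t = \sum_(0 <= k < tau p i)
    scalar_input z u t (sigma p i + k) * gprod p i k.+1.
Proof.
move=> iN; have tau0 := tau_gt0 iN.
have in_seg := @ltn_tau i.
rewrite /ppi !(big_ltn tau0)/= scalar_input_seg//; last exact: in_seg.
rewrite gprod1 !mulr1 addrA; congr (_ + _).
rewrite !big_nat; apply: eq_bigr => k ki.
by rewrite scalar_input_seg// ?ifF ?add0r//; [lia|apply: in_seg; lia].
Qed.

Lemma mu_weighted_future z u v t i : feasible p z u v -> (1 <= i <= nodes p)%N ->
  mu p z u i t = weighted_future (scalar_input z u t) (sigma p i).
Proof.
move=> feas iN; have [n ni] := ubnP (nodes p - i)%N.
elim: n => // n IH in i iN ni *.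
have in_seg : (i < nodes p)%N -> (tau p i <= delay p i)%N by move/tau_delay <-.
have input0 s : (settle_time <= s)%N -> scalar_input z u t s = 0.
  exact: scalar_input_tail feas.
rewrite mu_step// ppi_input// (weighted_future_unroll _ (tau p i) input0) prod_gain//.
congr (_ + _).
  rewrite !big_nat; apply: eq_bigr => k ki; rewrite prod_gain// => /in_seg; lia.
have [iltN|leNi] := ltnP i (nodes p).
  have tau0 := tau_gt0 iN.
  rewrite IH; [|lia|lia]; rewrite sigmaS; last by case/andP: iN.
  rewrite -(tau_delay iltN) /b /gprod [in RHS]big_nat_recr//=.
  congr (_ * _); rewrite mulrC; congr (_ * _).
  by rewrite /g X_past// ifF//; lia.
have -> : i = nodes p by lia.
by rewrite mu_last weighted_future_tail ?mulr0//= /settle_time /tau eqxx.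
Qed.

Lemma P_early i l m : (l.+2 <= m)%N -> P p i l.+2 m =
  (1 - X p i l.+2 / rho p i) * g p i l.+2 * P p i l.+1 m + X p i l.+2 / rho p i.
Proof. by move=> lm; rewrite {1}/P -/(P p i l.+1 m) lm. Qed.

Lemma P_late i l m : (m < l.+2)%N -> P p i l.+2 m =
  (1 - X p i l.+2 / rho p i) * P p i l.+1 m + X p i l.+2 / rho p i.
Proof. by move=> lm; rewrite {1}/P -/(P p i l.+1 m) leqNgt lm. Qed.

Lemma P_diag i l m : (l <= m)%N -> P p i l m = P p i l l.
Proof.
elim: l m => [//|[//|l] IH] m lm.
by rewrite (P_early _ lm) (P_early _ (leqnn _)) (IH _ (ltnW lm)) (IH l.+2).
Qed.

(** Closed-loop response to a unit input at step [k] of a segment. While that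
    input still lies ahead, the level is minus [P] times its offset; after it
    has arrived, the level is 1 minus [P]. The two branches of [P] are these two
    regimes, and by superposition all inputs beyond step [l] act through their
    common offset [m l - e l], with the coefficient [P] of the diagonal. *)
Lemma closed_loop_response i (y e m : nat -> R) n :
  (forall l, (l < n)%N -> y l.+1 = (1 - X p i l.+1 / rho p i) * y l + e l
     - X p i l.+1 / rho p i * m l) ->
  (forall l, (l < n)%N -> m l = e l + g p i l.+2 * m l.+1) ->
  forall l, (l < n)%N ->
  y l.+1 = (1 - P p i l.+1 1) * y 0%N
           + \sum_(0 <= k < l.+1) (1 - P p i l.+1 k.+1) * e k
           - P p i l.+1 l.+1 * (m l - e l).
Proof.
move=> yS mS; elim=> [|l IH] ln.
  by rewrite yS// big_nat1 /=; ring.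
have ln' := ltnW ln.
rewrite yS// IH//.
have -> : m l - e l = g p i l.+2 * m l.+1 by rewrite mS// addrAC subrr add0r.
rewrite [in RHS]big_nat_recr// P_late// P_early// (P_diag _ (leqnSn _)).
under [in RHS]eq_big_nat => k kl do rewrite P_late//.
set x := X p i l.+2 / _; set S := \sum_(0 <= k < l.+1) (1 - P p i l.+1 k.+1) * _.
have -> : \sum_(0 <= k < l.+1) (1 - ((1 - x) * P p i l.+1 k.+1 + x)) * e k
    = (1 - x) * S.
  by rewrite mulr_sumr; apply: eq_bigr => k _; ring.
by move: (P p i l.+1 1) (P p i l.+1 l.+1) S => P1 Pl S /=; ring.
Qed.

Lemma hS i : (0 < i)%N ->
  h p i = (1 - P p i (tau p i) 1) * b p i * h p i.-1
          + P p i (tau p i) (tau p i) * g p i.+1 1.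
Proof. by case: i => [//|[_|i _]//]; rewrite /= mulr0 add0r. Qed.

Lemma Phi_input z u i t : (1 <= i <= nodes p)%N ->
  Phi p z u i t = \sum_(0 <= k < tau p i)
    (1 - P p i (tau p i) k.+1) * scalar_input z u t (sigma p i + k)
    - (1 - P p i (tau p i) 1) * h p i.-1 * ppi p z u i t.
Proof.
move=> iN; have tau0 := tau_gt0 iN.
have in_seg := @ltn_tau i.
rewrite ppi_input// mulr_sumr -sumrB /Phi !(big_ltn tau0).
rewrite scalar_input_seg//; last exact: in_seg.
rewrite eqxx addrA; congr (_ + _); first by rewrite /phi; ring.
rewrite !big_nat; apply: eq_bigr => k ki.
by rewrite scalar_input_seg// ?ifF ?add0r /phi//; [ring|lia|apply: in_seg; lia].
Qed.

(** [delta] collects the effect of the inputs up to the segment of [i.-1], and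
    [h p i.-1] measures how much the anticipation of [mu p z u i t] has lowered
    the level that arrives at node [i]. The recursions of [Phi], [delta] and
    [h] are the response of one segment, once [mu p z u i t] is split into
    [ppi p z u i t] and the part that comes from [i.+1]. *)
Lemma pre_level_sigma z u v w t i :
  feasible p z u v -> stationary z v w -> terminal z w -> (1 <= i <= nodes p)%N ->
  pre_level z t (sigma p i) = delta p z u i.-1 t - h p i.-1 * mu p z u i t.
Proof.
move=> feas st term; elim: i => [//|i IH] iN.
have [->|i0] := posnP i; first by rewrite sigma1 /= mul0r subr0.
have iN' : (1 <= i <= nodes p)%N by lia.
have iltN : (i < nodes p)%N by lia.
have tau0 := tau_gt0 iN'.
have in_seg := @ltn_tau i.
have input0 s : (settle_time <= s)%N -> scalar_input z u t s = 0.
  exact: scalar_input_tail feas.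
pose y l := pre_level z t (sigma p i + l).
pose e l := scalar_input z u t (sigma p i + l).
pose m l := weighted_future (scalar_input z u t) (sigma p i + l).
have yS l : (l < tau p i)%N -> y l.+1 = (1 - X p i l.+1 / rho p i) * y l + e l
    - X p i l.+1 / rho p i * m l.
  move=> li; rewrite /y addnS (pre_level_costate _ _ feas st).
  rewrite (costate_feedback _ _ feas st term) /scalar_X seg_add ?addKn//; last exact: in_seg.
  by rewrite -/(y l) -/(e l) -/(m l); ring.
have mS l : (l < tau p i)%N -> m l = e l + g p i l.+2 * m l.+1.
  move=> li; rewrite /m addnS weighted_future_rec; last exact: input0.
  by rewrite gain_seg//; exact: in_seg.
have := closed_loop_response yS mS (l := (tau p i).-1).
rewrite prednK// => /(_ (leqnn _)) ; rewrite mS; last by rewrite prednK.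
rewrite prednK// /y addn0 IH// => yE.
rewrite sigmaS// -tau_delay// yE /=.
have -> : delta p z u i t
  = Phi p z u i t + (1 - P p i (tau p i) 1) * delta p z u i.-1 t by case: (i) i0.
have -> : m (tau p i) = mu p z u i.+1 t.
  by rewrite (mu_weighted_future t feas iN) sigmaS// -tau_delay.
have -> : g p i (tau p i).+1 = g p i.+1 1.
  by rewrite /g X_past// ifF//; lia.
by rewrite Phi_input// [h p i]hS// (mu_step _ _ _ iN') /e; ring.
Qed.

(** [v i t] is the multiplier that the scalar feedback predicts at
    [sigma p i], divided by the weight of the node. *)
Lemma stationary_external_law z u v w i t :
  feasible p z u v -> stationary z v w -> terminal z w -> (1 <= i <= nodes p)%N ->
  external_law p z u v i t.
Proof.
move=> feas st term iN; have [rv _] := st i t iN; rewrite /external_law.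
have r0 : rw p i != 0 by rewrite lt0r_neq0 ?rw_gt0.
have -> : v i t = w (t + sigma p i)%N / rw p i by rewrite -rv mulrC mulKf.
rewrite (costate_feedback _ _ feas st term) (pre_level_sigma _ feas st term)//.
by rewrite -(mu_weighted_future _ feas)// /scalar_X seg_sigma// subnn; field.
Qed.

(** The share of node [i] in the scalar level one step after [sigma p i] is
    [z i t.+1]; the dynamics of the node then give the flow that leaves it. *)
Lemma stationary_flow_law z u v w i t :
  feasible p z u v -> stationary z v w -> terminal z w -> (2 <= i <= nodes p)%N ->
  flow_law p z u i t.
Proof.
move=> feas st term iN; have iN' : (1 <= i <= nodes p)%N by lia.
have [_ qz] := st i t iN'; have := stationary_external_law t feas st term iN'.
have [_ _ _ dyn] := feas; have := dyn i t iN' isT.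
rewrite addrC -[1 + t%:Z]/(t.+1%:Z) /flow_law /external_law => zS vE.
have -> : u i.-1 t = z i t + u i (t%:Z - (tau p i)%:Z) + v i t + dist p i t - z i t.+1.
  by rewrite zS; ring.
have q0 : qw p i != 0 by rewrite lt0r_neq0 ?qw_gt0.
have r0 : rw p i != 0 by rewrite lt0r_neq0 ?rw_gt0.
have p0 : rho p i != 0 by rewrite lt0r_neq0 ?rho_gt0.
have -> : z i t.+1 = gam p i * pre_level z t (sigma p i).+1 / qw p i.
  have := costate_incr t (sigma p i) st; rewrite seg_sigma// -qz => <-.
  by rewrite mulrC mulKf.
rewrite (pre_level_costate _ _ feas st) (costate_feedback _ _ feas st term).
rewrite -(mu_weighted_future _ feas)// /scalar_X seg_sigma// subnn.
rewrite (pre_level_sigma _ feas st term)// vE.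
have := @scalar_input_seg z u t i 0 iN'; rewrite addn0 => ->.
  2: by move=> iltN; apply: delay_gt0; lia.
rewrite /inflow subn0 addr0 /a /c.
by rewrite eqxx; field; rewrite ?q0 ?r0 ?p0.
Qed.

(** * A stationary trajectory *)

Definition init_level : signal R := fun i _ => level0 p i.

Definition init_flow : signal R := fun i (t : int) =>
  if (i == 0%N) || (i == nodes p) then 0 else flow0 p i t.

Definition init_input s : R := scalar_input init_level init_flow 0 s.

Fixpoint opt_state s : R :=
  if s is s'.+1 then
    opt_state s' + init_input s'
    + - scalar_X s' * (opt_state s' + weighted_future init_input s') / rho p (seg s')
  else 0.

Definition opt_costate s : R := - scalar_X s * (opt_state s + weighted_future init_input s).

Lemma opt_stateS s :
  opt_state s.+1 = opt_state s + init_input s + opt_costate s / rho p (seg s).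
Proof. by []. Qed.

Definition opt_level : signal R := fun i (t : int) =>
  match t with
  | Posz 0 => level0 p i
  | Posz n.+1 =>
    (opt_costate (n + sigma p i).+1 - opt_costate (n + sigma p i)%N) / qw p i
  | Negz _ => 0
  end.

Definition opt_control : signal R := fun i (t : int) =>
  if t is Posz n then opt_costate (n + sigma p i)%N / rw p i else 0.

Definition required_inflow i s : R :=
  delayed_sum opt_level i s.+1 - delayed_sum opt_level i s
  - delayed_sum opt_control i s - D p i s.

(** Nodes 1, ..., i reach their total at delayed time [s.+1] only if they
    receive [required_inflow i s] from node [i.+1]; this flow is sent at the
    actual time [s - sigma p i.+1]. *)
Definition opt_flow : signal R := fun i (t : int) =>
  if (i == 0%N) || (i == nodes p) then 0 else
  if t is Posz n then required_inflow i (n + sigma p i.+1)%N else flow0 p i t.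

Lemma opt_stationary : stationary opt_level opt_control opt_costate.
Proof.
move=> i n iN; rewrite /opt_control /opt_level; split.
  by rewrite mulrC divfK// lt0r_neq0 ?rw_gt0.
by rewrite mulrC divfK// lt0r_neq0 ?qw_gt0.
Qed.

Lemma init_input_eq0 s : (settle_time <= s)%N -> init_input s = 0.
Proof.
by apply: scalar_input_eq0 => t; rewrite /init_flow eqxx orbT.
Qed.

Lemma pre_level_opt s : pre_level opt_level 0 s = opt_state s.
Proof.
elim: s => [//|s IH].
have g0 : gam p (seg s) != 0 by rewrite lt0r_neq0 ?gam_gt0 ?seg_in.
apply: (mulfI g0); rewrite -(costate_incr 0 s opt_stationary) add0n.
rewrite opt_stateS {1}/opt_costate opt_stateS.
apply: costate_forward (scalar_X_gt0 s.+1) _; first exact: seg_in.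
rewrite {1}/opt_costate scalar_X_riccati; congr (_ * (_ + _)).
by rewrite weighted_future_rec//; exact: init_input_eq0.
Qed.

Lemma opt_terminal : terminal opt_level opt_costate.
Proof.
move=> s Ks; have Ns : (sigma p (nodes p) <= s)%N by move: Ks; rewrite /settle_time; lia.
rewrite /opt_costate scalar_X_tail// weighted_future_tail// addr0 -pre_level_opt.
have := delayed_sum_pre_level opt_level 0 s; rewrite seg_tail// add0n => ->.
by rewrite joining_level_tail// addr0.
Qed.

(** A flow sent at a nonnegative time satisfies this by definition. A flow from
    the past is prescribed, and the equation is then the scalar dynamics. *)
Lemma opt_flow_required i s : (1 <= i <= nodes p)%N -> (sigma p i <= s)%N ->
  opt_flow i (s%:Z - (sigma p i)%:Z - (tau p i)%:Z) = required_inflow i s.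
Proof.
move=> iN lis; have [/andP[iltN lisS]|] := boolP ((i < nodes p)%N && (sigma p i.+1 <= s)%N).
  rewrite sigmaS in lisS; last by case/andP: iN.
  rewrite /opt_flow ifF; last by lia.
  rewrite tau_delay// -{1}(subnK lisS) sigmaS; last by case/andP: iN.
  rewrite (_ : _ - _ = (s - (sigma p i + delay p i))%N%:Z); last by lia.
  by rewrite subnK.
move=> out; have si : (i < nodes p)%N -> (s < sigma p i.+1)%N.
  by move=> iltN; move: out; rewrite iltN /= -ltnNge.
have eqi := seg_eq iN lis si.
have zS := pre_level_opt s.+1; rewrite opt_stateS /= add0n eqi in zS.
have zs := delayed_sum_pre_level opt_level 0 s; rewrite add0n eqi pre_level_opt in zs.
rewrite /required_inflow zS zs (delayed_sum_control opt_stationary)// -/(opt_costate s).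
rewrite /init_input /scalar_input /inflow eqi.
rewrite -[joining_level opt_level 0 s]/(joining_level init_level 0 s).
rewrite (_ : 0%:Z + sigma p i + (s - sigma p i)%N = s); last by lia.
set f := init_flow _ _; suff -> : opt_flow i (s%:Z - (sigma p i)%:Z - (tau p i)%:Z) = f.
  by ring.
rewrite /f /opt_flow /init_flow; case: ifP => // ine.
have iltN : (i < nodes p)%N by lia.
have := si iltN; rewrite sigmaS; last by case/andP: iN.
rewrite -tau_delay// => lts.
rewrite (_ : 0%:Z - _ = s%:Z - (sigma p i)%:Z - (tau p i)%:Z); last by lia.
by case E : (s%:Z - (sigma p i)%:Z - (tau p i)%:Z) => [n|n]//; lia.
Qed.

Lemma opt_flow_sent i n : (1 <= i <= nodes p)%N ->
  opt_flow i.-1 n = required_inflow i.-1 (n + sigma p i)%N.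
Proof.
case: i => [//|[_|i iN]] /=.
  by rewrite /required_inflow /D !delayed_sum0 big_geq// !subr0.
by rewrite /opt_flow ifF//; lia.
Qed.

Lemma opt_feasible : feasible p opt_level opt_flow opt_control.
Proof.
split=> [t|//|i t iN tN|i t iN].
- by rewrite /opt_flow /= eqxx orbT.
- by rewrite /opt_flow ifF; [case: t tN => //; lia|lia].
case: t => // n _; rewrite addrC -[1 + n%:Z]/(n.+1%:Z).
have := @opt_flow_required i (n + sigma p i) iN (leq_addl _ _).
rewrite PoszD addrK => ->; rewrite opt_flow_sent// /required_inflow.
case: i iN => [//|i] iN; rewrite [i.+1.-1]/= -![D p _ _]/(delayed_sum _ _ _) !delayed_sumS.
rewrite -addSn !PoszD !addrK.
by ring.
Qed.

(** * Stationarity tested against feasible trajectories *)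

Lemma scalar_input_init z u v s : feasible p z u v -> scalar_input z u 0 s = init_input s.
Proof.
move=> [u0 zi ui _]; have [sN lis _] := segP s.
rewrite /init_input /scalar_input /joining_level (zi _ sN).
congr (_ + (_ + _)); rewrite /init_flow.
case: ifP => [/orP[/eqP e|/eqP ->]|ine].
- by rewrite e (u0 _).1.
- by rewrite (u0 _).2.
have iltN : (seg s < nodes p)%N by lia.
have := seg_offset iltN => lt.
by rewrite ui//; rewrite ?tau_delay//; lia.
Qed.

(** The polar form of the cost of node [i] over one step. The level is taken
    one step later than the control: initial levels are data, and this is the
    grouping in which [w] telescopes. *)
Definition pair_node z v z' v' i n : R :=
  qw p i * z i n.+1 * z' i n.+1 + rw p i * v i n * v' i n.

(** Each node is truncated at the same delayed time [s], not at the same actual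
    time, so that no flow crosses the boundary. *)
Definition pairing z v z' v' s : R :=
  \sum_(1 <= i < (nodes p).+1) \sum_(0 <= n < s - sigma p i) pair_node z v z' v' i n.

Lemma pairingS z v z' v' s : pairing z v z' v' s.+1 = pairing z v z' v' s
  + \sum_(1 <= i < (seg s).+1) pair_node z v z' v' i (s - sigma p i).
Proof.
rewrite (big_nat_widen _ _ (nodes p).+1); last by have := seg_in s; lia.
rewrite [X in _ + X]big_mkcond /pairing -big_split/= !big_nat; apply: eq_bigr => i iN /=.
rewrite ltnS leq_seg//; case: leqP => si.
  by rewrite subSn// big_nat_recr.
by rewrite addr0 (_ : s.+1 - sigma p i = s - sigma p i)%N//; lia.
Qed.

(** Summation by parts: the contribution of delayed time [s] is
    [w s.+1 * y s.+1 - w s * y s - w s * e s], where [y] is the scalar level of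
    the second trajectory and [e] the initial data seen as an input. *)
Lemma pairing_costate z v w z' u' v' s : stationary z v w -> feasible p z' u' v' ->
  pairing z v z' v' s = w s * pre_level z' 0 s - \sum_(0 <= k < s) w k * init_input k.
Proof.
move=> st feas'; elim: s => [|s IH].
  rewrite [in RHS]big_geq// /= mulr0 subrr /pairing big1// => i _.
  by rewrite sub0n big_geq.
have [sN lis _] := segP s.
rewrite pairingS IH [in RHS]big_nat_recr//= -/(pre_level z' 0 s.+1).
have -> : \sum_(1 <= i < (seg s).+1) pair_node z v z' v' i (s - sigma p i)
    = (w s.+1 - w s) * pre_level z' 0 s.+1 + w s * delayed_sum v' (seg s) s.
  rewrite /pre_level add0n /delayed_sum !mulr_sumr -big_split/= !big_nat; apply: eq_bigr => i iN /=.
  have iN' : (1 <= i <= nodes p)%N by lia.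
  have lis' : (sigma p i <= s)%N by apply: leq_trans lis; apply: sigma_le; lia.
  have [rv qz] := st i (s - sigma p i)%N iN'; rewrite subnK// in rv qz.
  by rewrite /pair_node qz rv subzn ?leqW// subSn// subzn.
rewrite (pre_level_succ _ _ feas') add0n (scalar_input_init _ feas').
by ring.
Qed.

(** * Partial costs *)

Definition stage z v n : R :=
  \sum_(1 <= i < (nodes p).+1) (qw p i * z i n%:Z ^+ 2 + rw p i * v i n%:Z ^+ 2).

Definition partial_cost z v n : R := \sum_(0 <= k < n) stage z v k.

Definition initial_cost : R := \sum_(1 <= i < (nodes p).+1) qw p i * level0 p i ^+ 2.

Lemma stage_ge0 z v n : 0 <= stage z v n.
Proof.
rewrite /stage big_nat; apply: sumr_ge0 => i iN.
by rewrite addr_ge0// mulr_ge0 ?sqr_ge0// ltW ?qw_gt0 ?rw_gt0.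
Qed.

Lemma partial_cost_le_cost z v n : ((partial_cost z v n)%:E <= cost p z v)%E.
Proof.
rewrite /partial_cost -sumEFin; apply: nneseries_lim_ge => k _ _.
by rewrite lee_fin stage_ge0.
Qed.

Lemma cost_le z v c : (forall n, partial_cost z v n <= c) -> (cost p z v <= c%:E)%E.
Proof.
move=> le_c; apply: lime_le.
  by apply: is_cvg_nneseries => k _ _; rewrite lee_fin stage_ge0.
by near=> n; rewrite sumEFin lee_fin; exact: le_c.
Unshelve. all: by end_near. Qed.

(** This bound and the next one compare the two groupings of the cost of one
    node, with truncations that need not coincide. *)
Lemma shifted_sum_ge (x y : nat -> R) m n :
  (forall k, 0 <= x k) -> (forall k, 0 <= y k) -> (m <= n)%N ->
  \sum_(0 <= k < m) (x k + y k) <= x 0%N + \sum_(0 <= k < n) (x k.+1 + y k).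
Proof.
move=> x0 y0 mn; rewrite (@big_cat_nat _ _ _ m 0 n)//= addrA.
apply: le_trans (_ : x 0%N + \sum_(0 <= k < m) (x k.+1 + y k) <= _); last first.
  by rewrite lerDl; apply: sumr_ge0 => k _; rewrite addr_ge0.
rewrite !big_split addrA -(big_nat_recl m 0 x)//= lerD2r big_nat_recr//=.
by rewrite lerDl.
Qed.

Lemma shifted_sum_le (x y : nat -> R) m n :
  (forall k, 0 <= x k) -> (forall k, 0 <= y k) -> (m <= n)%N ->
  x 0%N + \sum_(0 <= k < m) (x k.+1 + y k) <= \sum_(0 <= k < n.+1) (x k + y k).
Proof.
move=> x0 y0 mn; rewrite (@big_cat_nat _ _ _ m.+1 0 n.+1)//=.
apply: le_trans (_ : \sum_(0 <= k < m.+1) (x k + y k) <= _); last first.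
  by rewrite lerDl; apply: sumr_ge0 => k _; rewrite addr_ge0.
rewrite !big_split addrA -(big_nat_recl m 0 x)//= lerD2l big_nat_recr//=.
by rewrite lerDl.
Qed.

Definition energy z v s : R := pairing z v z v s.

Lemma node_cost_ge0 z v i : (1 <= i <= nodes p)%N ->
  (forall k, 0 <= qw p i * z i k%:Z ^+ 2) /\ (forall k, 0 <= rw p i * v i k%:Z ^+ 2).
Proof.
by move=> iN; split=> k; rewrite mulr_ge0 ?sqr_ge0// ltW ?qw_gt0 ?rw_gt0.
Qed.

Lemma partial_cost_node z v n : partial_cost z v n = \sum_(1 <= i < (nodes p).+1)
  \sum_(0 <= k < n) (qw p i * z i k%:Z ^+ 2 + rw p i * v i k%:Z ^+ 2).
Proof. by rewrite /partial_cost exchange_big. Qed.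

Lemma initial_energy_node z u v s : feasible p z u v ->
  initial_cost + energy z v s = \sum_(1 <= i < (nodes p).+1) (qw p i * z i 0 ^+ 2 +
  \sum_(0 <= n < s - sigma p i) (qw p i * z i n.+1 ^+ 2 + rw p i * v i n ^+ 2)).
Proof.
move=> [_ zi _ _]; rewrite /initial_cost /energy -big_split/= !big_nat.
apply: eq_bigr => i iN /=; rewrite zi//; congr (_ + _).
by apply: eq_bigr => n _; rewrite /pair_node; ring.
Qed.

(** At delayed time [s] node [i] has only reached the actual time
    [s - sigma p i], which is earliest for the last node. *)
Lemma partial_cost_le_energy z u v n s : feasible p z u v ->
  (n + sigma p (nodes p) <= s)%N ->
  partial_cost z v n <= initial_cost + energy z v s.
Proof.
move=> feas ns; rewrite partial_cost_node (initial_energy_node _ feas).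
rewrite !big_nat; apply: ler_sum => i iN; have [q0 r0] := node_cost_ge0 z v iN.
apply: (shifted_sum_ge q0 r0).
have : (sigma p i <= sigma p (nodes p))%N by apply: sigma_le; lia.
by lia.
Qed.

Lemma energy_le_partial_cost z u v s : feasible p z u v ->
  initial_cost + energy z v s <= partial_cost z v s.+1.
Proof.
move=> feas; rewrite partial_cost_node (initial_energy_node _ feas).
rewrite !big_nat; apply: ler_sum => i iN; have [q0 r0] := node_cost_ge0 z v iN.
by apply: (shifted_sum_le q0 r0); exact: leq_subr.
Qed.

(** * Decay and optimality *)

Lemma Xend_lt_rho : Xend p < rho p (nodes p).
Proof.
rewrite -Xend_fix /riccati; have x0 := Xend_gt0.
have g0 := gam_gt0 nodes_in; have r0 := rho_gt0 nodes_in.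
move: (Xend p) (gam p _) (rho p _) x0 g0 r0 => x g r x0 g0 r0.
by rewrite ltr_pdivrMr ?addr_gt0// ltr_pM2l// ltrDl.
Qed.

Lemma costate_decay z u v w n : feasible p z u v -> stationary z v w -> terminal z w ->
  w (settle_time + n)%N = w settle_time * (1 - Xend p / rho p (nodes p)) ^+ n.
Proof.
move=> feas st term; elim: n => [|n IH]; first by rewrite addn0 mulr1.
have Kn : (settle_time <= settle_time + n)%N := leq_addr _ _.
have Nn : (sigma p (nodes p) <= settle_time + n)%N by rewrite /settle_time; lia.
have := pre_level_costate 0 (settle_time + n) feas st; rewrite (scalar_input_tail _ feas)// /=.
rewrite seg_tail// !add0n addr0 => aggE; have wE := term _ Kn.
have preE := delayed_sum_pre_level z 0 (settle_time + n).
rewrite seg_tail// add0n joining_level_tail// addr0 in preE; rewrite -preE in aggE.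
rewrite addnS (term _ (leqW Kn)) aggE exprSr mulrA -IH.
rewrite [in RHS]mulrBr mulr1 {2}wE; ring.
Qed.

Lemma costate_vanishes z u v w (eps : R) m :
  feasible p z u v -> stationary z v w -> terminal z w -> 0 < eps ->
  exists2 s, (m <= s)%N & `|w s| <= eps.
Proof.
move=> feas st term eps0.
have r0 := rho_gt0 nodes_in; have x0 := Xend_gt0; have xr := Xend_lt_rho.
have k1 : `|1 - Xend p / rho p (nodes p)| < 1.
  rewrite ltr_norml; have : Xend p / rho p (nodes p) < 1 by rewrite ltr_pdivrMr ?mul1r.
  have : 0 < Xend p / rho p (nodes p) by rewrite divr_gt0.
  by lra.
have /cvgr0_norm_le/(_ _ eps0) [M _ le_eps] := cvg_geometric (w settle_time) k1.
exists (settle_time + (M + m))%N; first by lia.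
by rewrite (costate_decay _ feas st term); apply: le_eps => /=; rewrite leq_addr.
Qed.

(** A finite cost bounds each level separately, by [`|x| <= 1 + x ^+ 2]. *)
Lemma pre_level_bounded z v c : (forall n, partial_cost z v n <= c) ->
  exists B : R, forall s, `|pre_level z 0 s| <= B.
Proof.
move=> le_c; exists (\sum_(1 <= i < (nodes p).+1) (1 + c / qw p i)).
have c0 : 0 <= c by have := le_c 0; rewrite /partial_cost big_geq.
have q0 i : (1 <= i < (nodes p).+1)%N -> 0 < qw p i by move=> iN; rewrite qw_gt0.
have term0 i : (1 <= i < (nodes p).+1)%N -> 0 <= 1 + c / qw p i.
  by move=> /q0 q; rewrite addr_ge0// divr_ge0// ltW.
have level_le i n : (1 <= i < (nodes p).+1)%N -> `|z i n| <= 1 + c / qw p i.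
  move=> iN; have q := q0 _ iN.
  suff le1 : z i n ^+ 2 <= c / qw p i.
    apply: le_trans (_ : 1 + z i n ^+ 2 <= _); last by rewrite lerD2l.
    by rewrite -real_normK ?num_real//; have := normr_ge0 (z i n); nra.
  rewrite ler_pdivlMr// mulrC; apply: le_trans (le_c n.+1).
  rewrite /partial_cost big_nat_recr//= ler_wpDl//.
    by apply: sumr_ge0 => k _; exact: stage_ge0.
  rewrite /stage (bigD1_seq i)/= ?mem_index_iota ?iota_uniq//.
  have [zq rv] := node_cost_ge0 z v iN.
  rewrite -addrA lerDl addr_ge0// big_seq_cond; apply: sumr_ge0 => j.
  rewrite mem_index_iota => /andP[jN _].
  by have [? ?] := node_cost_ge0 z v jN; rewrite addr_ge0.
case=> [|s]; first by rewrite normr0 big_nat; apply: sumr_ge0.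
have [sN lis _] := segP s.
rewrite /pre_level add0n /delayed_sum; apply: le_trans (ler_norm_sum _ _ _) _.
rewrite (@big_cat_nat _ _ _ (seg s).+1 1 (nodes p).+1)//=; last by lia.
apply: ler_wpDr.
  by rewrite big_nat; apply: sumr_ge0 => i iN; apply: term0; lia.
rewrite !big_nat; apply: ler_sum => i iN.
have lis' : (sigma p i <= s)%N by apply: leq_trans lis; apply: sigma_le; lia.
by rewrite subzn ?leqW// level_le//; lia.
Qed.

(** Test a stationary trajectory against itself: once settled, the boundary
    product is [- Xend p] times a square, and the inputs have stopped. *)
Lemma stationary_finite_cost z u v w :
  feasible p z u v -> stationary z v w -> terminal z w ->
  exists c, forall n, partial_cost z v n <= c.
Proof.
move=> feas st term.
exists (initial_cost - \sum_(0 <= k < settle_time) w k * init_input k) => n.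
have := @partial_cost_le_energy z u v n
  (settle_time + (n + sigma p (nodes p))) feas (leq_addl _ _).
move=> /le_trans; apply; rewrite /energy (pairing_costate _ st feas) lerD2l.
set s := (settle_time + _)%N; have Ks : (settle_time <= s)%N := leq_addr _ _.
rewrite (@big_cat_nat _ _ _ settle_time 0 s)//=.
rewrite (_ : \sum_(settle_time <= k < s) _ = 0); last first.
  by rewrite big_nat big1// => k /andP[Kk _]; rewrite init_input_eq0// mulr0.
rewrite addr0 gerDr; have := delayed_sum_pre_level z 0 s.
rewrite add0n joining_level_tail// addr0 => <-.
rewrite seg_tail; last by move: Ks; rewrite /settle_time; lia.
rewrite term//; have x0 := Xend_gt0.
by rewrite -mulrA mulNr oppr_le0 -expr2 mulr_ge0 ?sqr_ge0// ltW.
Qed.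

Definition signal_diff z' z : signal R := fun i (t : int) => z' i t - z i t.

Lemma energy_expand z v z' v' s :
  energy z' v' s = energy z v s + energy (signal_diff z' z) (signal_diff v' v) s
    + 2 * (pairing z v z' v' s - energy z v s).
Proof.
rewrite /energy /pairing -sumrB mulr_sumr -!big_split/=; apply: eq_bigr => i _.
rewrite -sumrB mulr_sumr -!big_split/=; apply: eq_bigr => n _.
by rewrite /pair_node /signal_diff; ring.
Qed.

Lemma pair_node_ge0 z v i n : (1 <= i <= nodes p)%N -> 0 <= pair_node z v z v i n.
Proof.
move=> iN; have [q0 r0] := node_cost_ge0 z v iN.
by rewrite /pair_node -!mulrA -!expr2 addr_ge0.
Qed.

Lemma energy_mono z v s s' : (s <= s')%N -> energy z v s <= energy z v s'.
Proof.
move=> ss; rewrite /energy /pairing !big_nat; apply: ler_sum => i iN.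
rewrite (@big_cat_nat _ _ _ (s - sigma p i) 0 (s' - sigma p i))//=; last by lia.
by rewrite lerDl; apply: sumr_ge0 => n _; apply: pair_node_ge0.
Qed.

Lemma energy_ge0 z v s : 0 <= energy z v s.
Proof.
rewrite /energy /pairing big_nat; apply: sumr_ge0 => i iN.
by apply: sumr_ge0 => n _; apply: pair_node_ge0.
Qed.

(** Expanding the cost of the competitor around the stationary trajectory, the
    cross term is twice [w s'] times the difference of the scalar levels, since
    both have the same initial data. The levels are bounded and [w] vanishes. *)
Lemma stationary_gap z u v w z' u' v' c n s :
  feasible p z u v -> stationary z v w -> terminal z w ->
  feasible p z' u' v' -> (forall m, partial_cost z' v' m <= c) ->
  partial_cost z v n + energy (signal_diff z' z) (signal_diff v' v) s <= c.
Proof.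
move=> feas st term feas' le_c; apply/ler_addgt0Pr => eps eps0.
have [c' le_c'] := stationary_finite_cost feas st term.
have [B leB] := pre_level_bounded le_c'; have [B' leB'] := pre_level_bounded le_c.
have B0 : 0 <= B := le_trans (normr_ge0 _) (leB 0%N).
have B'0 : 0 <= B' := le_trans (normr_ge0 _) (leB' 0%N).
(* The summand 1 keeps [C] positive when both bounds are zero. *)
pose C := 2 * (B + B') + 1; have C0 : 0 < C by rewrite /C; lra.
have [s' le_s' small] :=
  costate_vanishes (s + (n + sigma p (nodes p))) feas st term (divr_gt0 eps0 C0).
have := partial_cost_le_energy (n := n) (s := s') feas ltac:(lia).
have := energy_mono (signal_diff z' z) (signal_diff v' v) (s := s) (s' := s') ltac:(lia).
have := le_trans (energy_le_partial_cost s' feas') (le_c s'.+1).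
have cross : pairing z v z' v' s' - energy z v s'
    = w s' * (pre_level z' 0 s' - pre_level z 0 s').
  by rewrite /energy (pairing_costate _ st feas) (pairing_costate _ st feas'); ring.
have := energy_expand z v z' v' s'; rewrite cross.
have : `|w s' * (pre_level z' 0 s' - pre_level z 0 s')| * 2 <= eps.
  rewrite normrM; apply: le_trans (_ : eps / C * C <= _); last by rewrite divfK ?lt0r_neq0.
  rewrite -[leLHS]mulrA; apply: ler_pM; rewrite ?mulr_ge0//.
  have := ler_normB (pre_level z' 0 s') (pre_level z 0 s'); have := leB s'; have := leB' s'.
  by rewrite /C; lra.
have := ler_norm (- (w s' * (pre_level z' 0 s' - pre_level z 0 s'))); rewrite normrN.
by lra.
Qed.

Lemma finite_cost z v : (cost p z v < +oo)%E ->
  cost p z v = (fine (cost p z v))%:E.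
Proof.
move=> fin; rewrite fineK// ge0_fin_numE// (le_trans _ (partial_cost_le_cost z v 0))//.
by rewrite /partial_cost big_geq.
Qed.

Lemma stationary_optimal z u v w :
  feasible p z u v -> stationary z v w -> terminal z w -> optimal p z u v.
Proof.
move=> feas st term; split=> // z' u' v' feas'.
have [->|fin] := eqVneq (cost p z' v') +oo%E; first exact: leey.
have costE : cost p z' v' = (fine (cost p z' v'))%:E.
  by apply: finite_cost; rewrite ltey.
rewrite costE; apply: cost_le => n.
have le_c m : partial_cost z' v' m <= fine (cost p z' v').
  by rewrite -lee_fin -costE partial_cost_le_cost.
apply: le_trans (stationary_gap n 0 feas st term feas' le_c).
by rewrite lerDl energy_ge0.
Qed.

Lemma energy_eq0 z v i n : (1 <= i <= nodes p)%N -> (forall s, energy z v s <= 0) ->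
  z i n.+1%:Z = 0 /\ v i n%:Z = 0.
Proof.
move=> iN le0; have [q r] := (qw_gt0 iN, rw_gt0 iN).
have : pair_node z v z v i n <= 0.
  apply: le_trans (le0 (n.+1 + sigma p i)%N).
  rewrite /energy /pairing (bigD1_seq i)/= ?mem_index_iota ?iota_uniq//.
  rewrite addnK big_nat_recr//= addrAC lerDr addr_ge0//.
    by apply: sumr_ge0 => k _; exact: pair_node_ge0.
  rewrite big_seq_cond; apply: sumr_ge0 => j; rewrite mem_index_iota => /andP[jN _].
  by apply: sumr_ge0 => k _; exact: pair_node_ge0.
rewrite /pair_node -!mulrA -!expr2; have := sqr_ge0 (z i n.+1); have := sqr_ge0 (v i n).
move=> v0 z0 le; have zz : z i n.+1 ^+ 2 = 0 by nra.
have vv : v i n ^+ 2 = 0 by nra.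
by split; apply/eqP; rewrite -sqrf_eq0; apply/eqP.
Qed.

(** The gap leaves no room for a nonzero difference, and the difference of the
    initial levels is zero by feasibility. *)
Lemma optimal_unique z u v w z' u' v' i n :
  feasible p z u v -> stationary z v w -> terminal z w -> optimal p z' u' v' ->
  (1 <= i <= nodes p)%N -> z' i n%:Z = z i n%:Z /\ v' i n%:Z = v i n%:Z.
Proof.
move=> feas st term [feas' opt'] iN.
have [c' le_c'] := stationary_finite_cost feas st term.
have costE : cost p z v = (fine (cost p z v))%:E.
  by apply: finite_cost; apply: le_lt_trans (cost_le le_c') (ltry _).
have le_c m : partial_cost z' v' m <= fine (cost p z v).
  rewrite -lee_fin -costE; apply: le_trans (opt' _ _ _ feas).
  exact: partial_cost_le_cost.
have diff0 s : energy (signal_diff z' z) (signal_diff v' v) s <= 0.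
  rewrite -(lerD2l (fine (cost p z v))) addr0 -lerBrDr -lee_fin -costE.
  by apply: cost_le => k; rewrite lerBrDr; exact: (stationary_gap _ _ feas st term feas' le_c).
split; last by have [_] := energy_eq0 n iN diff0; move/eqP; rewrite subr_eq0 => /eqP.
case: n => [|n]; first by have [_ -> // _ _] := feas; have [_ -> // _ _] := feas'.
by have [+ _] := energy_eq0 n iN diff0; move/eqP; rewrite subr_eq0 => /eqP.
Qed.

(** * Determinacy of the laws *)

Definition same_outputs z v z' v' : Prop := forall i n,
  (1 <= i <= nodes p)%N -> z i n%:Z = z' i n%:Z /\ v i n%:Z = v' i n%:Z.

(** Node [i] receives at time [t + tau p i] the flow sent at [t], so its
    dynamics at that time express this flow by its level, its control and the
    flow that it sends on to node [i.-1]. *)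
Lemma same_outputs_flow z u v z' u' v' i (t : int) :
  feasible p z u v -> feasible p z' u' v' -> same_outputs z v z' v' ->
  (i <= nodes p)%N -> - (tau p i)%:Z <= t -> u i t = u' i t.
Proof.
move=> [u0 _ ui dyn] [u0' _ ui' dyn'] same.
elim: i t => [|i IH] t iN lt; first by rewrite (u0 _).1 (u0' _).1.
have [->|ne] := eqVneq i.+1 (nodes p); first by rewrite (u0 _).2 (u0' _).2.
have iltN : (1 <= i.+1 < nodes p)%N by lia.
have tE := tau_delay (i := i.+1) ltac:(lia).
have [t0|t0] := ltP t 0; first by rewrite ui ?ui'//; lia.
have [n nE] : exists n, t + (tau p i.+1)%:Z = n%:Z.
  by exists (absz (t + (tau p i.+1)%:Z)); lia.
have := dyn i.+1 n iN isT; have := dyn' i.+1 n iN isT.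
rewrite addrC -[1 + n%:Z]/(n.+1%:Z) /= IH; [|lia|lia].
have [-> ->] := same i.+1 n iN; have [-> _] := same i.+1 n.+1 iN.
rewrite -nE addrK => -> /eqP.
by rewrite -!addrA !(inj_eq (addrI _)) (inj_eq (addIr _)) => /eqP.
Qed.

(** Agreement in exactly what the laws read at time [t]: current levels and
    flows in transit. *)
Definition same_state z u z' u' (t : int) : Prop :=
  forall i, (1 <= i <= nodes p)%N -> z i t = z' i t /\
    forall t' : int, t - (tau p i)%:Z <= t' < t -> u i t' = u' i t'.

Lemma inflow_congr z u z' u' (t : int) i k : same_state z u z' u' t ->
  (1 <= i <= nodes p)%N -> (k < tau p i)%N -> inflow p u i t k = inflow p u' i t k.
Proof.
by move=> same iN ki; rewrite /inflow (same _ iN).2//; lia.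
Qed.

Lemma delta_congr z u z' u' (t : int) i : same_state z u z' u' t ->
  (i <= nodes p)%N -> delta p z u i t = delta p z' u' i t.
Proof.
move=> same; elim: i => [//|i IH] iN /=; rewrite IH ?(ltnW iN)//; congr (_ + _).
rewrite /Phi (same i.+1 iN).1; congr (_ + _); rewrite !big_nat; apply: eq_bigr => k ki.
by rewrite (inflow_congr same).
Qed.

Lemma mu_congr z u z' u' (t : int) i : same_state z u z' u' t -> (0 < i)%N ->
  mu p z u i t = mu p z' u' i t.
Proof.
move=> same i0; rewrite /mu; have : ((nodes p).+1 - i <= nodes p)%N by lia.
elim: (_ - i)%N => [//|k IH] kN /=; rewrite IH ?(ltnW kN)//; congr (_ + _).
have iN : (1 <= nodes p - k <= nodes p)%N by lia.
rewrite /ppi (same _ iN).1; congr (_ + _); rewrite !big_nat; apply: eq_bigr => j jt.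
by rewrite (inflow_congr same).
Qed.

Definition follows_law z u v : Prop := forall t : int, 0 <= t ->
  (forall i, (1 <= i <= nodes p)%N -> external_law p z u v i t) /\
  (forall i, (2 <= i <= nodes p)%N -> flow_law p z u i t).

Lemma external_law_congr z u v z' u' v' (t : int) i : same_state z u z' u' t ->
  (1 <= i <= nodes p)%N -> external_law p z u v i t -> external_law p z' u' v' i t <->
  v i t = v' i t.
Proof.
move=> same iN; rewrite /external_law => ->.
rewrite (delta_congr same); last by lia.
rewrite (mu_congr same); last by lia.
by split.
Qed.

Lemma flow_law_congr z u z' u' (t : int) i : same_state z u z' u' t ->
  (2 <= i <= nodes p)%N -> flow_law p z u i t -> flow_law p z' u' i t <->
  u i.-1 t = u' i.-1 t.
Proof.
move=> same iN; have iN' : (1 <= i <= nodes p)%N by lia.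
have tau0 := tau_gt0 iN'.
rewrite /flow_law => ->; have [-> uE] := same _ iN'.
rewrite uE; last by lia.
rewrite (delta_congr same); last by lia.
rewrite (mu_congr same); last by lia.
by split.
Qed.

Lemma same_state0 z u v z' u' v' : feasible p z u v -> feasible p z' u' v' ->
  same_state z u z' u' 0.
Proof.
move=> [u0 zi ui _] [u0' zi' ui' _] i iN; rewrite zi// zi'//; split=> // t tt.
have [->|ne] := eqVneq i (nodes p); first by rewrite (u0 _).2 (u0' _).2.
have tE : tau p i = delay p i by apply: tau_delay; lia.
rewrite tE in tt.
by rewrite ui ?ui'//; lia.
Qed.

Lemma law_unique z u v z' u' v' n : feasible p z u v -> feasible p z' u' v' ->
  follows_law z u v -> follows_law z' u' v' ->
  same_state z u z' u' n /\
  (forall i, (1 <= i <= nodes p)%N -> v i n = v' i n).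
Proof.
move=> feas feas' law law'.
have same_v (t : int) i : 0 <= t -> same_state z u z' u' t ->
    (1 <= i <= nodes p)%N -> v i t = v' i t.
  move=> t0 same iN; apply/(external_law_congr v' same iN).
    exact: (law t t0).1.
  exact: (law' t t0).1.
suff same : same_state z u z' u' n by split=> // i iN; exact: same_v.
elim: n => [|n IH]; first exact: same_state0 feas feas'.
have [u0 _ _ dyn] := feas; have [u0' _ _ dyn'] := feas'.
have same_u i : (i <= nodes p)%N -> u i n = u' i n.
  move=> iN; have [->|i0] := posnP i; first by rewrite (u0 _).1 (u0' _).1.
  have [->|ne] := eqVneq i (nodes p); first by rewrite (u0 _).2 (u0' _).2.
  have iN' : (2 <= i.+1 <= nodes p)%N by lia.
  by apply/(flow_law_congr IH iN'); [apply: (law n isT).2|apply: (law' n isT).2].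
move=> i iN; have [zE uE] := IH i iN.
have tau0 := tau_gt0 iN.
rewrite -[n.+1%:Z]/(1 + n%:Z) addrC; split=> [|t tn].
  rewrite dyn// dyn'// zE (same_v n i)// same_u ?uE//; lia.
have [->|tn'] := eqVneq t n; first by apply: same_u; lia.
by apply: uE; lia.
Qed.

Lemma same_outputs_law z u v z' u' v' : feasible p z u v -> feasible p z' u' v' ->
  same_outputs z v z' v' -> follows_law z u v -> follows_law z' u' v'.
Proof.
move=> feas feas' same law [n|//] _.
have sameu i (t : int) := same_outputs_flow (i := i) (t := t) feas feas' same.
have state : same_state z u z' u' n.
  move=> i iN; split=> [|t tn]; first exact: (same i n iN).1.
  by apply: sameu; lia.
have [ext flow] := law n isT; split=> i iN.
  by apply/(external_law_congr v' state iN (ext i iN)); exact: (same i n iN).2.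
by apply/(flow_law_congr state iN (flow i iN)); apply: sameu; lia.
Qed.

Lemma stationary_law z u v w :
  feasible p z u v -> stationary z v w -> terminal z w -> follows_law z u v.
Proof.
move=> feas st term [n|//] _; split=> i iN.
  exact: (stationary_external_law _ feas st term iN).
exact: (stationary_flow_law _ feas st term iN).
Qed.

Lemma cost_congr z v z' v' : same_outputs z v z' v' -> cost p z v = cost p z' v'.
Proof.
move=> same; apply: eq_eseriesr => k _; congr (_%:E); rewrite !big_nat.
by apply: eq_bigr => i iN; have [-> ->] := same i k iN.
Qed.

Lemma optimal_iff_law z u v : feasible p z u v -> optimal p z u v <-> follows_law z u v.
Proof.
move=> feas; have opt := stationary_optimal opt_feasible opt_stationary opt_terminal.
have law := stationary_law opt_feasible opt_stationary opt_terminal.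
split=> [opt'|law'].
  apply: (same_outputs_law opt_feasible feas _ law) => i n iN.
  by have [-> ->] := optimal_unique n opt_feasible opt_stationary opt_terminal opt' iN.
split=> // z' u' v' feas'; rewrite (@cost_congr z v opt_level opt_control).
  by have [_ minimal] := opt; exact: minimal feas'.
move=> i n iN; have [state ->//] := law_unique n feas opt_feasible law' law.
by have [-> _] := state i iN.
Qed.

End Scalar.

Theorem theorem1 (R : realType) (p : problem R)
  (nodes_ge2 : (2 <= nodes p)%N)
  (delay_gt0 : forall i : nat, (1 <= i < nodes p)%N -> (0 < delay p i)%N)
  (qw_gt0 : forall i : nat, (1 <= i <= nodes p)%N -> 0 < qw p i)
  (rw_gt0 : forall i : nat, (1 <= i <= nodes p)%N -> 0 < rw p i)
  (dist_planned : forall (i : nat) (t : int), (1 <= i <= nodes p)%N ->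
     (horizon p)%:Z + ((sigma p (nodes p))%:Z - (sigma p i)%:Z) < t ->
     dist p i t = 0) :
  (exists z u v : signal R, optimal p z u v) /\
  (forall z u v : signal R, feasible p z u v ->
     (optimal p z u v <->
      forall t : int, 0 <= t ->
        (forall i : nat, (1 <= i <= nodes p)%N -> external_law p z u v i t) /\
        (forall i : nat, (2 <= i <= nodes p)%N -> flow_law p z u i t))).
Proof.
split=> [|z u v feas]; last exact: optimal_iff_law.
exists (opt_level p), (opt_flow p), (opt_control p).
apply: (@stationary_optimal _ p _ _ _ _ _ _ _ _ (opt_costate p)) => //.
- exact: opt_feasible.
- exact: opt_stationary.
- exact: opt_terminal.
Qed.
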